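(* Let $X$ and $Y$ be Banach spaces with $X$ separable. Then for each surjective bounded linear operator $B:X\to Y$ there is a closed subspace $U\subseteq X$ such that the restriction $A:=B|_U:U\to Y$ is injective and its range $\mathcal{R}(A)$ is dense in $Y$.
   Context: $\mathcal{R}(A)$ denotes the range of the operator $A$. *)

(* Defs.v *)
From mathcomp Require Export all_boot all_order all_algebra.
From mathcomp Require Export complex.
From mathcomp Require Export all_classical all_reals all_analysis.
Export numFieldNormedType.Exports.

Set Implicit Arguments.
Unset Strict Implicit.
Unset Printing Implicit Defensive.

Local Open Scope classical_set_scope.
Local Open Scope ring_scope.

(* Results on Banach spaces are understood over the real numbers and over the
   complex numbers alike. *)
Variant scalar_kind := RealScalars | ComplexScalars.

Definition scalar_field (R : realType) (k : scalar_kind) : numFieldType :=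
  match k with
  | RealScalars => R
  | ComplexScalars => R[i]
  end.

Definition separable (T : topologicalType) : Prop :=
  exists2 D : set T, countable D & dense D.

Definition closed_subspace (K : numFieldType) (X : normedModType K)
    (U : set X) : Prop :=
  GRing.submod_closed [in U] /\ closed U.

(* Main.v *)
From HB Require Import structures.
From mathcomp Require Import ring.
Require Import Defs.

(** Since [B] is onto, [U] has to be a quasi-complement of [ker B]: closed,
    meeting [ker B] only in [0], and with [U + ker B] dense.  Such a [U] is
    cut out by countably many continuous functionals, obtained from two
    biorthogonal systems.

    On the kernel side, a sequence of functionals norming a dense sequence
    separates the points of [X] ([norming_total_seq]).  Orthogonalizing it
    against vectors of [ker B] gives functionals [phi k] that still separate
    points, and [z k] in [ker B], such that [phi k (z l) = 0] for [k != l],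
    while [phi k (z k) = 1] unless [phi k] vanishes on [ker B].

    On the range side, orthogonalizing a dense sequence of [X] against the
    functionals [g \o B], for [g] in the dual of [Y], gives vectors [x m] with
    dense linear span and functionals [y' m] on [Y] such that
    [y' m (B (x l)) = 0] for [m != l], while [y' m (B (x m)) = 1] unless
    [B (x m) = 0].  Both systems come from one lemma on pairings,
    [biorthogonalization].

    Correct [x m] inside its class modulo [ker B] to a vector [u m] killed by
    the [phi k] with [k < m] and [phi k (z k) = 1], and let [U] be the set of
    [w] such that [phi k w] is equal to the sum over [m <= k] of
    [phi k (u m) * y' m (B w)], for every [k] with [phi k (z k) = 1].  By the
    correction, a finite sum is enough for the equations to hold at every
    [u m], and a finite sum makes them closed conditions.  So [U] is closed and
    [B U] contains the span of the [B (x m)], which is dense.  If [w] is in [U]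
    and [B w = 0], then these [phi k] vanish at [w] by the equations and the
    others because [w] is in [ker B], so [w = 0].

    The functionals come from the Hahn-Banach theorem, proved over the reals
    for a sublinear majorant by taking a minimal sublinear function below it,
    and transferred to complex spaces by [f x - i f (i x)]. *)

Set Implicit Arguments.
Unset Strict Implicit.
Unset Printing Implicit Defensive.

Import Order.TTheory GRing.Theory Num.Theory.

Local Open Scope classical_set_scope.
Local Open Scope ring_scope.

(** * The Hahn-Banach theorem for sublinear functions *)

Section HahnBanach.
Variables (R : realType) (V : lmodType R).
Implicit Types (p q : V -> R) (F : set (V -> R)) (x y : V) (s t : R).

(** Only the inequality is required in the homogeneity clause, as it is what an
    infimum inherits; equality follows, see [sublinearZ]. *)
Definition sublinear p :=
  (forall x y, p (x + y) <= p x + p y) /\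
  (forall t x, 0 <= t -> p (t *: x) <= t * p x).

Lemma sublinearZ p t x : sublinear p -> 0 <= t -> p (t *: x) = t * p x.
Proof.
move=> [pD pZ] t0; apply/le_anti; rewrite pZ//=.
have [->|tn0] := eqVneq t 0.
  by rewrite mul0r; move: (pD 0 0); rewrite addr0 scale0r -lerBlDr subrr.
have {}t0 : 0 < t by rewrite lt0r tn0.
rewrite -ler_pdivlMl//.
by have := pZ t^-1 (t *: x); rewrite scalerA mulVf// scale1r invr_ge0 ltW//; apply.
Qed.

Lemma sublinear_geN p x : sublinear p -> - p (- x) <= p x.
Proof.
move=> sp; have := sp.1 x (- x); rewrite subrr.
have := sublinearZ 0 sp (lexx 0); rewrite scale0r mul0r => ->.
by rewrite -lerBlDr sub0r.
Qed.

(** Both infima used below are instances: the infimum of a chain of sublinear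
    functions, and that of the one-parameter family in [sublinear_lower], whose
    members are not sublinear themselves.  This is why the two closure
    hypotheses may answer with another member of [F]. *)
Lemma sublinear_inf F : F !=set0 ->
    (forall x, has_lbound [set f x | f in F]) ->
    (forall f g x y, F f -> F g -> exists2 h, F h & h (x + y) <= f x + g y) ->
    (forall f t x, F f -> 0 <= t -> exists2 h, F h & h (t *: x) <= t * f x) ->
  sublinear (fun x => inf [set f x | f in F]).
Proof.
move=> [f0 Ff0] Flb FD FZ.
have Fn0 x : [set f x | f in F] !=set0 by exists (f0 x); exists f0.
have infF f x : F f -> inf [set g x | g in F] <= f x.
  by move=> Ff; apply: ge_inf => //; exists f.
split=> [x y|t x t0].
- rewrite -lerBlDr; apply: lb_le_inf => // _ [f Ff <-].
  rewrite lerBlDr -lerBlDl; apply: lb_le_inf => // _ [g Fg <-].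
  rewrite lerBlDl; have [h Fh] := FD f g x y Ff Fg.
  exact/le_trans/infF.
- have [t00|tn0] := eqVneq t 0.
    have [h Fh] := FZ _ _ x Ff0 t0; rewrite t00 !mul0r; exact/le_trans/infF.
  have {}t0 : 0 < t by rewrite lt0r tn0.
  rewrite -ler_pdivrMl//; apply: lb_le_inf => // _ [f Ff <-].
  rewrite ler_pdivrMl//; have [h Fh] := FZ f t x Ff (ltW t0).
  exact/le_trans/infF.
Qed.

(** The function [q] is the infimum over [s >= 0] of
    [p (x + s *: x0) - s * p x0]: letting [s = 0] bounds it by [p], and [s = 1]
    gives its value at [- x0].  It serves twice, to make the dominated functional
    attain [p x0] and to show that a minimal sublinear function is odd. *)
Lemma sublinear_lower p x0 : sublinear p ->
  exists q, [/\ sublinear q, forall x, q x <= p x & q (- x0) <= - p x0].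
Proof.
move=> sp; pose F := [set (fun x => p (x + s *: x0) - s * p x0) | s in [set s | 0 <= s]].
have Flb x : has_lbound [set f x | f in F].
  exists (- p (- x)) => _ [_ [s /= s0 <-] <-].
  rewrite lerBrDl lerBlDr -sublinearZ//.
  by rewrite (le_trans _ (sp.1 _ _))// addrAC subrr add0r.
have Fle s x : 0 <= s -> inf [set f x | f in F] <= p (x + s *: x0) - s * p x0.
  move=> s0; apply: ge_inf => //; exists (fun x => p (x + s *: x0) - s * p x0) => //.
  by exists s.
exists (fun x => inf [set f x | f in F]); split => [|x|].
- apply: sublinear_inf => //.
  + by exists (fun x => p (x + 0 *: x0) - 0 * p x0); exists 0 => //=.
  + move=> _ _ x y [s /= s0 <-] [t /= t0 <-].
    exists (fun x => p (x + (s + t) *: x0) - (s + t) * p x0).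
      by exists (s + t) => //=; rewrite addr_ge0.
    rewrite [leRHS]addrACA -opprD -mulrDl lerD2r scalerDl addrACA; exact: sp.1.
  + move=> _ t x [s /= s0 <-] t0.
    exists (fun x => p (x + (t * s) *: x0) - (t * s) * p x0).
      by exists (t * s) => //=; rewrite mulr_ge0.
    rewrite -scalerA -scalerDr mulrBr mulrA lerD2r; exact: sp.2.
- by have := Fle 0 x (lexx _); rewrite scale0r addr0 mul0r subr0.
- have := Fle 1 (- x0) ler01; rewrite scale1r addNr mul1r.
  by have := sublinearZ 0 sp (lexx 0); rewrite scale0r mul0r => ->; rewrite sub0r.
Qed.

(** Zorn's lemma applies because every sublinear [q <= p] is bounded below by
    [- p (- x)] at [x], so that chains have an infimum. *)
Lemma sublinear_minimal p : sublinear p ->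
  exists q, [/\ sublinear q, forall x, q x <= p x &
    forall r, sublinear r -> (forall x, r x <= q x) -> forall x, q x <= r x].
Proof.
move=> sp; pose S := {q | sublinear q /\ forall x, q x <= p x}.
pose inS q (sq : sublinear q) (qp : forall x, q x <= p x) : S :=
  exist _ q (conj sq qp).
pose below : rel S := [rel f g : S | `[< forall x, sval g x <= sval f x >]].
have [||A Atot|[q [sq qp]] /= qmin] := @ZL_preorder S (inS _ sp (fun=> lexx _)) below.
- by move=> f; apply/asboolP.
- move=> f g h /asboolP gf /asboolP hg; apply/asboolP => x.
  exact: le_trans (hg x) (gf x).
- have [A0|An0] := pselect (A = set0).
    by exists (inS _ sp (fun=> lexx _)) => f; rewrite A0.
  have {An0} [f0 Af0] : A !=set0 by apply/set0P/eqP.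
  pose F := [set sval f | f in A].
  have Flb x : has_lbound [set f x | f in F].
    exists (- p (- x)) => _ [_ [[f [sf fp]] /= _ <-] <-].
    by rewrite (le_trans _ (sublinear_geN x sf))// lerN2.
  have Fle (f : S) x : A f -> inf [set f x | f in F] <= sval f x.
    by move=> Af; apply: ge_inf => //; exists (sval f) => //; exists f.
  have sF : sublinear (fun x => inf [set f x | f in F]).
    apply: sublinear_inf => //.
    + by exists (sval f0); exists f0.
    + move=> _ _ x y [f Af <-] [g Ag <-].
      have [/asboolP gf|/asboolP fg] := Atot _ _ Af Ag.
      * exists (sval g); first by exists g.
        by rewrite (le_trans ((svalP g).1.1 _ _))// lerD2r.
      * exists (sval f); first by exists f.
        by rewrite (le_trans ((svalP f).1.1 _ _))// lerD2l.
    + move=> _ t x [f Af <-] t0; exists (sval f); first by exists f.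
      exact: (svalP f).1.2.
  have Fp x : inf [set f x | f in F] <= p x.
    exact: le_trans (Fle f0 x Af0) ((svalP f0).2 x).
  exists (inS _ sF Fp) => f Af; apply/asboolP => x /=; exact: Fle.
exists q; split => // r sr rq x.
have rp y : r y <= p y by exact: le_trans (rq y) (qp y).
have := qmin (inS _ sr rp).
by move=> /(_ (asboolT rq))/asboolP/(_ x).
Qed.

(** A minimal sublinear function [f] is linear: it is equal to the function
    that [sublinear_lower] puts below it, so [f (- x) <= - f x], and an odd
    sublinear function is linear. *)
Lemma hahn_banach_sublinear p x0 : sublinear p ->
  exists f : V -> R, [/\ scalar f, forall x, f x <= p x & f x0 = p x0].
Proof.
move=> sp; have [q [sq qp qx0]] := sublinear_lower x0 sp.
have [f [sf fq fmin]] := sublinear_minimal sq.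
have fN x : f (- x) = - f x.
  apply/le_anti/andP; split; last by rewrite lerNl sublinear_geN.
  have [r [sr rf rx]] := sublinear_lower x sf.
  by rewrite (le_trans _ rx)// fmin.
exists f; split=> [|x|].
- have fD x y : f (x + y) = f x + f y.
    apply/le_anti; rewrite sf.1/= -lerN2 -fN opprD (le_trans (sf.1 _ _))//.
    by rewrite !fN opprD.
  move=> t x y; rewrite fD; congr (_ + _).
  have [t0|/ltW t0] := leP 0 t; first exact: sublinearZ.
  by rewrite -[LHS]opprK -fN -scaleNr sublinearZ ?oppr_ge0// mulNr opprK.
- exact: le_trans (fq x) (qp x).
- apply/le_anti; rewrite (le_trans (fq x0) (qp x0))//=.
  by rewrite -lerN2 -fN (le_trans (fq _)).
Qed.

End HahnBanach.

(** * Biorthogonal systems *)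

Lemma course_of_values (T : Type) (F : seq T -> T) :
  exists s : nat -> T, forall n, s n = F (mkseq s n).
Proof.
pose hist := fix hist n := if n is m.+1 then rcons (hist m) (F (hist m)) else [::].
exists (fun n => F (hist n)) => n; congr F.
by elim: n => // n IHn /=; rewrite mkseqS -IHn.
Qed.

Lemma scalar_comb (K : pzRingType) (V : lmodType K) (f : V -> K) n v
    (c : 'I_n -> K) (u : 'I_n -> V) : scalar f ->
  f (v - \sum_(i < n) c i *: u i) = f v - \sum_(i < n) c i * f (u i).
Proof.
move=> flin.
pose g : {scalar V} := HB.pack f (GRing.isLinear.Build K V K *%R f flin).
rewrite -[f]/(g : _ -> _) linearB linear_sum; congr (_ - _).
by apply: eq_bigr => i _; rewrite linearZ.
Qed.

Lemma submod_closed_comb (K : pzRingType) (V : lmodType K) (P : set V) n v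
    (c : 'I_n -> K) (u : 'I_n -> V) : GRing.submod_closed [in P] ->
  P v -> (forall i, P (u i)) -> P (v - \sum_(i < n) c i *: u i).
Proof.
move=> [P0 PL] Pv Pu; apply/set_mem.
have PB w x : w \in P -> x \in P -> w - x \in P.
  by move=> Pw Px; rewrite addrC -scaleN1r; exact: PL.
apply: PB; first exact: mem_set.
elim/big_ind : _ => // [x y Px Py|i _].
  by rewrite -[x]scale1r; exact: PL.
by rewrite -[_ *: _]addr0; apply: PL => //; exact: mem_set.
Qed.

(** Gram-Schmidt on both sides of a pairing, the second vector being chosen
    after the first: [e n] is [v n] made orthogonal to the earlier [e' i]; if it
    pairs nontrivially with some [w] in [P], then [e' n] is [w] made orthogonal
    to the earlier [e i], which does not change the pairing with [e n], and then
    normalized.  Otherwise [e' n = 0] and [v n] contributes nothing new modulo the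
    orthogonal of [P].  The indices of such [n] are kept, so that the recurrence
    for [e] is uniform. *)
Lemma biorthogonalization (K : fieldType) (V W : lmodType K) (b : V -> W -> K)
    (P : set W) (v : nat -> V) :
    (forall x, scalar (b x)) -> (forall y, scalar (b^~ y)) ->
    GRing.submod_closed [in P] ->
  exists (e : nat -> V) (e' : nat -> W),
    [/\ forall n, e n = v n - \sum_(i < n) b (v n) (e' i) *: e i,
        forall n, P (e' n),
        forall m n, m != n -> b (e m) (e' n) = 0 &
        forall n, b (e n) (e' n) = 1 \/ forall w, P w -> b (e n) w = 0].
Proof.
move=> br bl Psub.
have scalarE (U : lmodType K) (f : U -> K) : scalar f ->
    f 0 = 0 /\ forall t x, f (t *: x) = t * f x.
  move=> flin; have f0 : f 0 = 0.
    by have := flin (-1) 0 0; rewrite scaler0 addr0 mulN1r addNr.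
  by split=> // t x; have := flin t x 0; rewrite f0 !addr0.
have P0 : P 0 by exact: set_mem Psub.1.
have PZ t w : P w -> P (t *: w).
  move=> Pw; apply: set_mem; rewrite -[_ *: _]addr0; apply: Psub.2.
    exact: mem_set.
  exact: Psub.1.
have [pick pickP] : {pick : V -> W & forall x, P (pick x) /\
    (b x (pick x) != 0 \/ forall w, P w -> b x w = 0)}.
  suff pick_ex x : exists w, P w /\ (b x w != 0 \/ forall y, P y -> b x y = 0).
    by have [f fP] := choice pick_ex; exists f.
  have [[w Pw bw]|h] := pselect (exists2 w, P w & b x w != 0).
    by exists w; split; last left.
  exists 0; split => //; right => w Pw.
  by apply/eqP/negPn/negP => bw; apply: h; exists w.
(* The list [s] holds the pairs already built. *)
pose first_step (s : seq (V * W)) : V := v (size s) -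
  \sum_(i < size s) b (v (size s)) (nth (0, 0) s i).2 *: (nth (0, 0) s i).1.
pose dual_step (s : seq (V * W)) (x : V) : W := (b x (pick x))^-1 *: (pick x -
  \sum_(i < size s) b (nth (0, 0) s i).1 (pick x) *: (nth (0, 0) s i).2).
have [s sE] := course_of_values (fun s => (first_step s, dual_step s (first_step s))).
pose e n := (s n).1; pose e' n := (s n).2.
have eE n : e n = v n - \sum_(i < n) b (v n) (e' i) *: e i.
  rewrite /e sE /= /first_step size_mkseq; congr (_ - _).
  by apply: eq_bigr => i _; rewrite nth_mkseq.
pose w n := pick (e n).
(* If [e n] is orthogonal to [P], the inverse below is [0^-1 = 0], so that
   [e' n] is automatically [0]. *)
have e'E n : e' n = (b (e n) (w n))^-1 *: (w n - \sum_(i < n) b (e i) (w n) *: e' i).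
  have -> : e' n = dual_step (mkseq s n) (e n) by rewrite /e' /e sE.
  rewrite /dual_step size_mkseq; congr (_ *: (_ - _)).
  by apply: eq_bigr => i _; rewrite nth_mkseq.
have Pw n : P (w n) by exact: (pickP _).1.
have wP n : b (e n) (w n) != 0 \/ forall y, P y -> b (e n) y = 0 by exact: (pickP _).2.
clearbody e e' w; clear sE first_step dual_step s pickP.
have Pe' n : P (e' n).
  elim/ltn_ind: n => n IHn; rewrite e'E.
  by apply/PZ/(submod_closed_comb _ Psub) => // i; exact: IHn.
have [b0 bZ] : (forall x, b x 0 = 0) /\ forall x t y, b x (t *: y) = t * b x y.
  by split=> x; have [] := scalarE _ _ (br x).
pose biorth n := (b (e n) (e' n) = 1 \/ e' n = 0 /\ forall y, P y -> b (e n) y = 0) /\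
  forall i, (i < n)%N -> b (e n) (e' i) = 0 /\ b (e i) (e' n) = 0.
have biorthP n : biorth n.
  elim/ltn_ind: n => n IHn.
  (* Orthogonality below [n] leaves one term in each correcting sum. *)
  have sum_below (c d : 'I_n -> K) (i : 'I_n) :
      (forall j, j != i -> d j = 0) -> \sum_(j < n) c j * d j = c i * d i.
    move=> d0; rewrite (bigD1 i)//= big1 ?addr0// => j ji.
    by rewrite d0// mulr0.
  have orth_below (i j : 'I_n) : i != j -> b (e i) (e' j) = 0.
    rewrite neq_ltn => /orP[ij|ji].
      exact: ((IHn j (ltn_ord j)).2 i ij).2.
    exact: ((IHn i (ltn_ord i)).2 j ji).1.
  have en0 (i : 'I_n) : b (e n) (e' i) = 0.
    rewrite eE (scalar_comb _ _ _ (bl (e' i))) (sum_below _ _ i) => [|j ji].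
      have [[->|[-> _]] _] := IHn i (ltn_ord i); first by rewrite mulr1 subrr.
      by rewrite !b0 mul0r subrr.
    exact: orth_below.
  have e'n0 (i : 'I_n) : b (e i) (e' n) = 0.
    rewrite e'E bZ (scalar_comb _ _ _ (br (e i))) (sum_below _ _ i) => [|j ji].
      have [[->|[_ ->//]] _] := IHn i (ltn_ord i).
        by rewrite mulr1 subrr mulr0.
      by rewrite mul0r subrr mulr0.
    by apply: orth_below; rewrite eq_sym.
  split=> [|i lin]; last by split; [exact: (en0 (Ordinal lin))|exact: (e'n0 (Ordinal lin))].
  have [bw|bw] := wP n.
    left; rewrite e'E bZ (scalar_comb _ _ _ (br (e n))) big1 ?subr0 ?mulVf// => i _.
    by rewrite en0 mulr0.
  by right; split; rewrite // e'E bw// invr0 scale0r.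
exists e, e'; split.
- exact: eE.
- exact: Pe'.
- move=> m n; rewrite neq_ltn => /orP[/(biorthP n).2[]|/(biorthP m).2[]] //.
- by move=> n; have [[bn|[_ bn]] _] := biorthP n; [left|right].
Qed.

(** * Continuous functionals *)

Section Dual.
Variables (K : numFieldType) (X : normedModType K).

Definition dual_pred : {pred X -> K^o} :=
  fun f => `[< linear f /\ continuous f >].

Lemma dual_pred_submod_closed : GRing.submod_closed dual_pred.
Proof.
split.
  apply/asboolP; split; last exact: cst_continuous.
  by move=> a x y; rewrite /= scaler0 addr0.
move=> a f g /asboolP[fL fC] /asboolP[gL gC]; apply/asboolP; split.
  move=> b x y; rewrite !fctE/= fL gL scalerDr scalerDr addrACA; congr (_ + _).
  by rewrite !scalerA mulrC.
move=> x; apply: cvgD; last exact: gC.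
apply: cvgZr; exact: fC.
Qed.

HB.instance Definition _ := GRing.isSubmodClosed.Build K (X -> K^o) dual_pred
  dual_pred_submod_closed.

Record dual := Dual { dual_fun :> X -> K^o; _ : dual_fun \in dual_pred }.
HB.instance Definition _ := [isSub for dual_fun].
HB.instance Definition _ := [Choice of dual by <:].
HB.instance Definition _ := [SubChoice_isSubLmodule of dual by <:].

Lemma dual_scalar (f : dual) : scalar f.
Proof. by case: f => f /= /asboolP[]. Qed.

HB.instance Definition _ (f : dual) :=
  GRing.isLinear.Build K X K^o *:%R f (dual_scalar f).

Lemma dual_continuous (f : dual) : continuous f.
Proof. by case: f => f /= /asboolP[]. Qed.

Lemma dual_eval_scalar (x : X) : scalar (fun f : dual => f x : K).
Proof. by []. Qed.

Lemma dual_of_norm_le (f : X -> K^o) : linear f -> (forall x, `|f x| <= `|x|) ->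
  exists g : dual, g = f :> (X -> K^o).
Proof.
move=> fL fle; pose h : {linear X -> K^o} := HB.pack f (GRing.isLinear.Build K X K^o *:%R f fL).
have fC : continuous f.
  apply: (@bounded_linear_continuous _ _ _ h); apply/linear_boundedP.
  by near=> r => x; rewrite (le_trans (fle x))// ler_peMl//; near: r; exact: nbhs_pinfty_ge.
by exists (Dual (asboolT (conj fL fC) : f \in dual_pred)).
Unshelve. all: by end_near. Qed.

End Dual.
Arguments dual_eval_scalar {K X} x.

(** The form of the Hahn-Banach theorem used for quasi-complements, common to
    real and complex scalars. *)
Definition has_norming_functionals (K : numFieldType) (X : normedModType K) :=
  forall x : X, exists2 f : dual X, forall y, `|f y| <= `|y| & `|f x| = `|x|.

Lemma hahn_banach_real (R : realType) (X : normedModType R) : has_norming_functionals X.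
Proof.
move=> x; have [|f [fL fle fx]] := @hahn_banach_sublinear R X (fun y => `|y|) x.
  by split=> [y z|t y t0]; rewrite ?ler_normD// normrZ ger0_norm.
have fN y : f (- y) = - f y.
  have f0 : f 0 = 0 by have := fL (-1) 0 0; rewrite scaler0 addr0 mulN1r addNr.
  by rewrite -scaleN1r -[_ *: _]addr0 fL f0 addr0 mulN1r.
have [||g gf] := @dual_of_norm_le R X f.
- exact: fL.
- by move=> y; rewrite ler_norml fle lerNl -fN -[`|y|]normrN fle.
exists g; rewrite gf; last by rewrite fx normr_id.
by move=> y; rewrite ler_norml fle lerNl -fN -[`|y|]normrN fle.
Qed.

Section Complex.
Variables (R : realType).

(** A type alias carrying the scalar multiplication restricted to the reals. *)
Definition realified (X : lmodType R[i]) : Type := X.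
HB.instance Definition _ (X : lmodType R[i]) := GRing.Zmodule.on (realified X).

Section RealifiedScale.
Variable X : lmodType R[i].
Definition realified_scale (t : R) (x : realified X) : realified X :=
  (t%:C%C *: (x : X)).
Lemma realified_scaleA a b x :
  realified_scale a (realified_scale b x) = realified_scale (a * b) x.
Proof. by rewrite /realified_scale scalerA rmorphM. Qed.
Lemma realified_scale1 : left_id 1 realified_scale.
Proof. by move=> x; rewrite /realified_scale rmorph1 scale1r. Qed.
Lemma realified_scaleDr : right_distributive realified_scale +%R.
Proof. by move=> a x y; rewrite /realified_scale scalerDr. Qed.
Lemma realified_scaleDl x : {morph realified_scale^~ x : a b / a + b}.
Proof. by move=> a b; rewrite /realified_scale rmorphD scalerDl. Qed.
HB.instance Definition _ := GRing.Zmodule_isLmodule.Build R (realified X)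
  realified_scaleA realified_scale1 realified_scaleDr realified_scaleDl.
End RealifiedScale.

(** A real-linear [f] dominated by the norm is the real part of the
    complex-linear [F x = f x - i f (i x)].  A unit scalar [c] that makes
    [F (c x)] equal to [`|F x|] turns the bound on [f (c x)] into the bound
    [`|F x| <= `|x|]. *)
Lemma hahn_banach_complex (X : normedModType R[i]) : has_norming_functionals X.
Proof.
move=> x0.
have normE (x : X) : (complex.Re (`|x| : R[i]))%:C%C = `|x| :> R[i].
  by rewrite RRe_real// normr_real.
pose p (x : realified X) : R := complex.Re (`|x : X| : R[i]).
have sp : sublinear p.
  split=> [x y|t x t0].
    by rewrite -lecR rmorphD/= !normE ler_normD.
  by rewrite -lecR rmorphM/= !normE normrZ ger0_norm// lecR.
have [f [fL fle fx]] := hahn_banach_sublinear (x0 : realified X) sp.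
have fD x y : f (x + y) = f x + f y.
  by have := fL 1 x y; rewrite scale1r mul1r.
have f0 : f 0 = 0.
  by have := fD 0 0; rewrite addr0 => /esym/eqP; rewrite -subr_eq0 addrK => /eqP.
have fZ (t : R) (x : X) : f (t%:C%C *: x) = t * f x.
  by have := fL t x 0; rewrite f0 !addr0.
pose F (x : X) : R[i] := (f x -i* f ('i%C *: x))%C.
have fcomb (a b : R) (x : X) :
    f ((a +i* b)%C *: x) = a * f x + b * f ('i%C *: x).
  have -> : (a +i* b)%C = a%:C%C + b%:C%C * 'i%C by rewrite [LHS]complexE mulrC.
  by rewrite scalerDl -scalerA fD !fZ.
have fN (x : X) : f (- x) = - f x.
  by rewrite -scaleN1r -(rmorph1 (real_complex R)) -rmorphN fZ mulN1r.
have FD a (x y : X) : F (a *: x + y) = a * F x + F y :> R[i].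
  case: a => a b.
  have Fre : f ((a +i* b)%C *: x + y) = a * f x + b * f ('i%C *: x) + f y.
    by rewrite fD fcomb.
  have Fim : f ('i%C *: ((a +i* b)%C *: x + y)) =
      a * f ('i%C *: x) - b * f x + f ('i%C *: y).
    rewrite scalerDr fD scalerA mulrC -scalerA fcomb scalerA -expr2 sqr_i scaleN1r fN.
    by rewrite mulrN.
  rewrite /F Fre Fim; congr Complex; rewrite /=.
    ring.
  ring.
have FL : linear (F : X -> R[i]^o) by exact: FD.
have Fle (x : X) : `|F x| <= `|x|.
  have [->|Fx0] := eqVneq (F x) 0; first by rewrite normr0.
  pose c : R[i] := `|F x| / F x.
  have c1 : `|c| = 1 by rewrite normrM normrV ?unitfE// normr_id divff ?normr_eq0.
  have Fcx : F (c *: x) = `|F x|.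
    have := FD c x 0; rewrite addr0 => ->.
    have -> : F 0 = 0 by rewrite /F scaler0 f0 oppr0.
    by rewrite addr0 divfK.
  rewrite -[leRHS]mul1r -c1 -normrZ -Fcx -normE -[leLHS]RRe_real.
    by rewrite lecR fle.
  by rewrite Fcx normr_real.
have [g gF] := dual_of_norm_le FL Fle.
exists g; rewrite gF //; apply/le_anti; rewrite Fle /=.
rewrite (le_trans _ (normc_ge_Re _))//= fx -[leLHS]normE lecR.
exact: ler_norm.
Qed.
End Complex.

(** * Quasi-complements *)

Lemma separable_dense_seq (T : topologicalType) (t : T) :
  separable T -> exists v : nat -> T, dense (range v).
Proof.
move=> [D /pfcard_geP cD dD]; have [d [_ Dd]] := dD setT (ex_intro _ t I) openT.
case: cD => [D0|[v]]; first by move: Dd; rewrite D0.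
exists v => O O0 oO; have [y [Oy Dy]] := dD O O0 oO.
by have [n _ vn] := 'surj_v Dy; exists y; split => //; exists n.
Qed.

Section Total.
Variables (K : numFieldType) (X : normedModType K).

Lemma preannihilator_closed_subspace (H : set (dual X)) :
  closed_subspace [set x | forall h, H h -> h x = 0].
Proof.
split; first split.
- by apply/mem_set => h _; rewrite linear0.
- move=> a x y /set_mem/= x0 /set_mem/= y0; apply/mem_set => h Hh /=.
  by rewrite linearP /= x0// y0// scaler0 addr0.
- have -> : [set x | forall h, H h -> h x = 0] = \bigcap_(h in H) (h @^-1` [set 0]).
    by apply/seteqP; split.
  apply: closed_bigI => h _; apply: preimage_closed => [x _|]; first exact: dual_continuous.
  exact/accessible_closed_set1/hausdorff_accessible/norm_hausdorff.
Qed.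

(** If all functionals norming the [v n] vanish at [x], then
    [`|v n| <= `|v n - x|] for all [n], which fails for [v n] close to [x != 0]. *)
Lemma norming_total_seq (v : nat -> X) : has_norming_functionals X ->
  dense (range v) ->
  exists f : nat -> dual X, forall x, (forall n, f n x = 0) -> x = 0.
Proof.
move=> norming vdense.
have [f fP] : {f : nat -> dual X & forall n,
    (forall x, `|f n x| <= `|x|) /\ `|f n (v n)| = `|v n|}.
  suff ex_f n : exists f : dual X, (forall x, `|f x| <= `|x|) /\ `|f (v n)| = `|v n|.
    by have [f fP] := choice ex_f; exists f.
  by have [f fle fx] := norming (v n); exists f.
exists f => x fx0; apply/eqP/negPn/negP => x0.
have x2 : 0 < `|x| / 2 by rewrite divr_gt0 ?normr_gt0.
have [|y [xv [n _ vn]]] := vdense (ball x (`|x| / 2)) _ (ball_open _ _).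
  by exists x; exact: ballxx.
move: xv; rewrite -vn -ball_normE/= => xv.
have : `|v n| < `|x| / 2.
  have fvE : f n (v n - x) = f n (v n) by rewrite linearB/= fx0 subr0.
  by rewrite -(fP n).2 -fvE (le_lt_trans ((fP n).1 _))// distrC.
move=> /(ltrD xv); rewrite -splitr => /(le_lt_trans (ler_normD _ _)).
by rewrite subrK ltxx.
Qed.

End Total.

Section QuasiComplement.
Variables (K : numFieldType) (X Y : normedModType K) (B : {linear X -> Y}).

Lemma dual_comp (g : dual Y) : continuous B -> exists h : dual X, forall x, h x = g (B x).
Proof.
move=> cB.
have h_in : (g \o B : X -> K^o) \in @dual_pred K X.
  apply/asboolP; split; first by move=> a x y /=; rewrite !linearP.
  by move=> x; apply: continuous_comp; [exact: cB|exact: dual_continuous].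
by exists (Dual h_in).
Qed.

(** [U] is given by equations and not as the closed span of the [u m]: this
    makes it closed at once, turns [B w = 0] into [phi k w = 0], and leaves the
    equations to be checked at the [u m] only. *)
Theorem closed_quasicomplement_ker : separable X -> continuous B ->
    set_surj [set: X] [set: Y] B ->
    has_norming_functionals X -> has_norming_functionals Y ->
  exists U : set X, [/\ closed_subspace U,
    forall x, U x -> B x = 0 -> x = 0 & dense [set B x | x in U]].
Proof.
move=> sepX cB sB nX nY.
have [v vdense] := separable_dense_seq 0 sepX.
have [f ftotal] := norming_total_seq nX vdense.
have kerB_sub : GRing.submod_closed [in [set x | B x = 0]].
  split; first by apply/mem_set; rewrite /= linear0.
  move=> a x y /set_mem/= x0 /set_mem/= y0; apply/mem_set => /=.
  by rewrite linearP x0 y0 scaler0 addr0.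
have [phi [z [phiE zker phiz0 phiz]]] := biorthogonalization f
  (@dual_scalar K X) dual_eval_scalar kerB_sub.
have [|||x [y' [xE _ xy0 xy]]] := @biorthogonalization K X (dual Y) (fun x g => g (B x)) setT v.
- by move=> x; exact: dual_eval_scalar.
- by move=> g a x y; rewrite linearP dual_scalar.
- by split=> [|a g g' _ _]; exact: in_setT.
(* The correction by the [z i], which lie in [ker B], makes [u m] orthogonal to
   [phi k] for all [k < m] with [phi k (z k) = 1].  When [B (x m) = 0] the
   number [y' m (B (x m))] is [0] instead of [1], and [0] is the correction that
   satisfies the equations of [U]. *)
pose u m := if B (x m) == 0 then 0
  else x m - \sum_(i < m) phi i (x m) *: z i.
have Bu m : B (u m) = B (x m).
  rewrite /u; case: eqP => [->|_]; first by rewrite linear0.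
  rewrite linearB linear_sum big1 ?subr0// => i _.
  by rewrite linearZ/= (zker i : B (z i) = 0) scaler0.
have [yB yBE] : {yB : nat -> dual X & forall m w, yB m w = y' m (B w)}.
  by have [yB yBE] := choice (fun m => dual_comp (y' m) cB); exists yB.
pose h k := phi k - \sum_(m < k.+1) phi k (u m) *: yB m.
have hE k w : h k w = phi k w - \sum_(m < k.+1) phi k (u m) * y' m (B w).
  rewrite (scalar_comb _ _ _ (dual_eval_scalar w)); congr (_ - _).
  by apply: eq_bigr => m _; rewrite yBE.
pose U := [set w | forall g, [set h k | k in [set k | phi k (z k) = 1]] g -> g w = 0].
have subU : closed_subspace U by exact: preannihilator_closed_subspace.
(* For [j <= k] only the term [m = j] of the sum remains; for [j > k] that term
   is absent and [phi k (u j) = 0]. *)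
have uU j : U (u j).
  move=> _ [k /= phik <-].
  have [Bx0|Bx0] := eqVneq (B (x j)) 0.
    by rewrite /u Bx0 eqxx linear0.
  have y'j m : y' m (B (u j)) = (m == j)%:R.
    rewrite Bu; case: (eqVneq m j) => [->|mj]; last by rewrite xy0// eq_sym.
    have [//|gx0] := xy j.
    have [g _ gx] := nY (B (x j)).
    have gx00 : g (B (x j)) = 0 by exact: gx0.
    by move: gx; rewrite gx00 normr0 => /esym/eqP; rewrite normr_eq0 (negbTE Bx0).
  rewrite hE; have [jk|kj] := leqP j k.
    rewrite (bigD1 (Ordinal (jk : (j < k.+1)%N)))//= big1 => [|m mj].
      by rewrite y'j eqxx mulr1 addr0 subrr.
    by rewrite y'j (_ : _ == _ = false) ?mulr0//; apply/negbTE.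
  rewrite big1 => [|m _].
    rewrite subr0 /u (negbTE Bx0) (scalar_comb _ _ _ (dual_scalar (phi k))).
    rewrite (bigD1 (Ordinal kj))//= phik mulr1 big1 ?addr0 ?subrr// => i ik.
    by rewrite phiz0 ?mulr0// eq_sym.
  rewrite y'j (_ : _ == _ = false) ?mulr0//; apply/ltn_eqF.
  by rewrite (leq_trans (ltn_ord m)).
exists U; split=> // [w wU Bw0|O [y Oy] oO].
- apply: ftotal => q.
  have phi0 k : phi k w = 0.
    have [phik|->//] := phiz k.
    have := wU (h k) (ex_intro2 _ _ k phik erefl).
    rewrite hE Bw0 big1 ?subr0// => m _.
    by rewrite linear0 mulr0.
  have : phi q w = f q w - \sum_(i < q) f q (z i) * phi i w.
    by rewrite [in LHS]phiE (scalar_comb _ _ _ (dual_eval_scalar w)).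
  by rewrite phi0 big1 ?subr0 => [<-//|i _]; rewrite phi0 mulr0.
- have [w _ Bw] := sB y I.
  have [||v' [Ov [q _ vq]]] := vdense (B @^-1` O).
  + by exists w; rewrite /= Bw.
  + by apply: open_comp => // ? _; exact: cB.
  exists (B (v q)); split; first by rewrite vq.
  (* The recurrence for [x] writes [v q] as a combination of [x 0], .., [x q]; the
     same combination of the [u i] is a preimage in [U]. *)
  pose c (i : 'I_q) := - y' i (B (v q)).
  exists (u q - \sum_(i < q) c i *: u i).
    by apply: (submod_closed_comb _ subU.1) => // i; exact: uU.
  have -> : v q = x q - \sum_(i < q) c i *: x i.
    have -> : \sum_(i < q) c i *: x i = - \sum_(i < q) y' i (B (v q)) *: x i.
      by rewrite -sumrN; apply: eq_bigr => i _; rewrite scaleNr.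
    by rewrite opprK [x q]xE subrK.
  rewrite !linearB !linear_sum Bu; congr (_ + _).
  by apply: eq_bigr => i _; rewrite /= !linearZ/= Bu.
Qed.
End QuasiComplement.

Theorem corollary4 (R : realType) (k : scalar_kind)
    (X Y : completeNormedModType (scalar_field R k)) (hX : separable X)
    (B : {linear X -> Y}) (hBbounded : bounded_near B (nbhs (0 : X)))
    (hBsurj : set_surj [set: X] [set: Y] B) :
  exists U : set X,
    [/\ closed_subspace U,
        injective (sigL U B) &
        dense (range (sigL U B))].
Proof.
have norming (Z : normedModType (scalar_field R k)) : has_norming_functionals Z.
  by case: k Z {X Y hX B hBbounded hBsurj} => Z;
    [exact: hahn_banach_real|exact: hahn_banach_complex].
have [U [subU injU denseU]] := closed_quasicomplement_ker hX
  (bounded_linear_continuous hBbounded) hBsurj (norming X) (norming Y).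
exists U; split=> //.
- move=> [x xU] [y yU]; rewrite /sigL/= => Bxy; apply/val_inj => /=.
  apply/eqP; rewrite -subr_eq0; apply/eqP/injU; last by rewrite linearB Bxy subrr.
  have [_ UL] := subU.1; apply: set_mem; rewrite addrC -scaleN1r.
  exact: UL.
- suff -> : range (sigL U B) = [set B x | x in U] by [].
  apply/seteqP; split=> [_ [[x xU] _ <-]|_ [x xU <-]].
    by exists x => //; exact: set_mem.
  by exists (SigSub (mem_set xU)).
Qed.
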